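(* Let $\mathcal{C}$ be a hereditary class of graphs. Then $\mathcal{C}$ is intersectionwise $\chi$-imposing if and only if $\mathcal{C}$ is colorable, i.e. there is an integer $k$ such that $\chi(G)\le k$ for every $G\in\mathcal{C}$.
   Context: All graphs are finite, simple and undirected; all graph classes are hereditary (closed under isomorphism and induced subgraphs). The intersection of graphs $G_1,\dots,G_k$ is the graph $(\bigcap_{i} V(G_i),\bigcap_i E(G_i))$. For graph classes $\mathcal{G}_1,\dots,\mathcal{G}_k$, their graph-intersection is the class of all graphs $G$ such that $G=G_1\cap\dots\cap G_k$ for some $G_i\in\mathcal{G}_i$ ($i\in[k]$). A class $\mathcal{D}$ is $\chi$-bounded if there is a non-decreasing function $f:\mathbb{N}\to\mathbb{N}$ with $\chi(G)\le f(\omega(G))$ for all $G\in\mathcal{D}$. A class $\mathcal{A}$ is intersectionwise $\chi$-imposing if for every class of graphs $\mathcal{B}$ the graph-intersection of $\mathcal{A}$ and $\mathcal{B}$ is $\chi$-bounded. *)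

(* Defs.v *)
From mathcomp Require Import all_boot finmap.

Set Implicit Arguments.
Unset Strict Implicit.
Unset Printing Implicit Defensive.

Local Open Scope fset_scope.

(* Vertices are drawn from the fixed countably infinite set nat, so that graphs
   with different vertex sets can be intersected.  Nothing is lost: the graphs
   are finite and the classes considered are closed under isomorphism.  The
   null graph is allowed, since an intersection may have no vertices. *)
Definition pairs (A : {fset nat}) : {fset {fset nat}} :=
  [fset e in fpowerset A | #|` e| == 2].

Record graph := Graph {
  vertices : {fset nat};
  edges : {fset {fset nat}};
  edgesP : edges `<=` pairs vertices
}.

Lemma in_pairs (A e : {fset nat}) :
  (e \in pairs A) = (e `<=` A) && (#|` e| == 2).
Proof. by rewrite !inE /= fpowersetE. Qed.

Lemma graph_eq (G H : graph) :
  vertices G = vertices H -> edges G = edges H -> G = H.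
Proof.
case: G H => [V E p] [V' E' p'] /= eV eE; subst V' E'.
by rewrite (bool_irrelevance p p').
Qed.

Definition adj (G : graph) (u v : nat) : bool := [fset u; v] \in edges G.

Definition isomorphic (G H : graph) : Prop :=
  exists f : vertices G -> vertices H,
    bijective f /\
    forall u v : vertices G, adj H (val (f u)) (val (f v)) = adj G (val u) (val v).

Lemma induced_subproof (G : graph) (S : {fset nat}) :
  [fset e in edges G | e `<=` S] `<=` pairs (vertices G `&` S).
Proof.
apply/fsubsetP => e; rewrite !inE /= => /andP[eG eS].
have /fsubsetP/(_ e eG) := edgesP G.
by rewrite in_pairs => /andP[eV e2]; rewrite fpowersetE fsubsetI eV eS.
Qed.

Definition induced (G : graph) (S : {fset nat}) : graph :=
  Graph (induced_subproof G S).

Lemma cap_subproof (G H : graph) :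
  edges G `&` edges H `<=` pairs (vertices G `&` vertices H).
Proof.
apply/fsubsetP => e; rewrite in_fsetI => /andP[eG eH].
have /fsubsetP/(_ e eG) := edgesP G; have /fsubsetP/(_ e eH) := edgesP H.
by rewrite !in_pairs fsubsetI => /andP[-> _] /andP[-> ->].
Qed.

Definition graph_cap (G H : graph) : graph := Graph (cap_subproof G H).

Definition proper_coloring (G : graph) (k : nat) (c : {ffun vertices G -> 'I_k}) : bool :=
  [forall u, forall v, adj G (val u) (val v) ==> (c u != c v)].

Definition k_colorable (G : graph) (k : nat) : bool :=
  [exists c : {ffun vertices G -> 'I_k}, proper_coloring c].

Lemma adj_irrefl (G : graph) (u : nat) : adj G u u = false.
Proof.
apply/negP => uG; have /fsubsetP/(_ _ uG) := edgesP G.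
by rewrite in_pairs fsetUid cardfs1 andbF.
Qed.

Lemma ex_k_colorable (G : graph) : exists k, k_colorable G k.
Proof.
exists #|{: vertices G}|; apply/existsP; exists [ffun u => enum_rank u].
apply/forallP => u; apply/forallP => v; apply/implyP => uv.
rewrite !ffunE (inj_eq enum_rank_inj); apply: contraTneq uv => ->.
by rewrite adj_irrefl.
Qed.

Definition chi (G : graph) : nat := ex_minn (ex_k_colorable G).

Definition clique (G : graph) (S : {set vertices G}) : bool :=
  [forall u in S, forall v in S, (u != v) ==> adj G (val u) (val v)].

Definition omega (G : graph) : nat :=
  \max_(S : {set vertices G} | clique S) #|S|.

Definition graph_class := graph -> Prop.

Definition hereditary (C : graph_class) : Prop :=
  (forall G H, isomorphic G H -> C G -> C H) /\
  (forall G S, C G -> C (induced G S)).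

Definition graph_intersection (A B : graph_class) : graph_class :=
  fun G => exists G1 G2, [/\ A G1, B G2 & G = graph_cap G1 G2].

Definition chi_bounded (D : graph_class) : Prop :=
  exists f : nat -> nat,
    {homo f : m n / m <= n} /\ forall G, D G -> chi G <= f (omega G).

(* B ranges over hereditary classes: by convention every graph class is one. *)
Definition intersectionwise_chi_imposing (A : graph_class) : Prop :=
  forall B : graph_class, hereditary B -> chi_bounded (graph_intersection A B).

Definition colorable (C : graph_class) : Prop :=
  exists k : nat, forall G, C G -> chi G <= k.

(* Main.v *)
Require Import Defs.
From mathcomp Require Import all_boot finmap zify.

(** Rödl's argument.  Intersecting [C] with the class of all graphs yields all
    subgraphs of members of [C], so it suffices that a graph of large chromatic
    number has a triangle-free subgraph of large chromatic number.  A large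
    clique contains a large shift graph.  Otherwise, by induction on the clique
    number, every neighbourhood [N(u)] has a [t]-colouring [c_u]; giving an edge
    [uv] with [u] before [v] the label [c_u(v)] splits the edges into [t]
    triangle-free graphs, since the two edges leaving the first vertex of a
    triangle get different labels.  If each of these graphs is [k]-colourable,
    then the whole graph is [k ^ t]-colourable. *)

Set Implicit Arguments.
Unset Strict Implicit.
Unset Printing Implicit Defensive.

Local Open Scope fset_scope.

(** * Colourings of relations and cliques *)

Definition rel_colorable (T : finType) (e : rel T) (k : nat) : bool :=
  [exists c : {ffun T -> 'I_k}, [forall u, forall v, e u v ==> (c u != c v)]].

(** The three vertices need not be distinct, so such a relation also has no loops. *)
Definition triangle_free (T : Type) (e : rel T) : Prop :=
  forall u v w, e u v -> e v w -> e u w -> False.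

Definition triangle_free_subrels_colorable (T : finType) (e : rel T) (k : nat) :=
  forall e' : rel T, symmetric e' -> subrel e' e -> triangle_free e' ->
    rel_colorable e' k.

Definition rel_clique (T : finType) (e : rel T) (S : {set T}) : Prop :=
  {in S &, forall u v, u != v -> e u v}.

Lemma rel_colorableP (T : finType) (e : rel T) (k : nat) :
  reflect (exists c : T -> 'I_k, forall u v, e u v -> c u != c v)
          (rel_colorable e k).
Proof.
apply: (iffP existsP) => [[c /forallP ce]|[c ce]].
  by exists c => u v; apply/implyP; move/forallP: (ce u).
exists (finfun c); apply/forallP => u; apply/forallP => v.
by apply/implyP => /ce; rewrite !ffunE.
Qed.

Lemma rel_colorable_card (T K : finType) (e : rel T) (c : T -> K) :
  (forall u v, e u v -> c u != c v) -> rel_colorable e #|K|.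
Proof.
move=> ce; apply/rel_colorableP; exists (enum_rank \o c) => u v /ce.
by rewrite (inj_eq enum_rank_inj).
Qed.

Lemma rel_colorable_le (T : finType) (e : rel T) (k l : nat) :
  k <= l -> rel_colorable e k -> rel_colorable e l.
Proof.
move=> kl /rel_colorableP[c ce]; apply/rel_colorableP.
by exists (widen_ord kl \o c).
Qed.

Lemma rel_colorable_neighborhoods (T : finType) (e : rel T) (k t : nat) :
  symmetric e -> triangle_free_subrels_colorable e k ->
  (forall v, rel_colorable [rel x y | [&& e x y, e v x & e v y]] t) ->
  rel_colorable e (k ^ t).
Proof.
move=> sym_e ke te.
have /fin_all_exists[c cP] v : exists cv : T -> 'I_t,
  forall x y, [&& e x y, e v x & e v y] -> cv x != cv y by apply/rel_colorableP/te.
(* [enum_rank] orders the vertices; [d i] consists of the edges with label [i], directed upwards,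
   and [e_ i] is its symmetric closure. *)
pose d i := [rel u v | [&& e u v, enum_rank u < enum_rank v & c u v == i]].
pose e_ i := [rel u v | d i u v || d i v u].
have no_fork i u v w : d i u v -> d i u w -> e v w -> False.
  move=> /and3P[uv _ /eqP cv] /and3P[uw _ /eqP cw] vw.
  by have := cP u v w; rewrite vw uv uw cv cw eqxx => /(_ isT).
have d_lt i u v : d i u v -> enum_rank u < enum_rank v by case/and3P.
have e_sub i : subrel (e_ i) e.
  by move=> u v /orP[] /and3P[] //; rewrite sym_e.
have e_sym i : symmetric (e_ i) by move=> u v; rewrite /= orbC.
have e_tf i : triangle_free (e_ i).
  move=> u v w uv vw uw.
  have [[euv evw] euw] := (e_sub _ _ _ uv, e_sub _ _ _ vw, e_sub _ _ _ uw).
  (* Of the eight orientations of the triangle two are cyclic and contradict the order; each of the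
     others has a source, which [no_fork] excludes. *)
  case/orP: uv => uv; case/orP: vw => vw; case/orP: uw => uw.
  - exact: no_fork uv uw evw.
  - by have := ltn_trans (d_lt _ _ _ uv) (ltn_trans (d_lt _ _ _ vw) (d_lt _ _ _ uw)); rewrite ltnn.
  - exact: no_fork uv uw evw.
  - by apply: no_fork vw uw _; rewrite sym_e.
  - exact: no_fork uv vw euw.
  - exact: no_fork uv vw euw.
  - by have := ltn_trans (d_lt _ _ _ uv) (ltn_trans (d_lt _ _ _ uw) (d_lt _ _ _ vw)); rewrite ltnn.
  - by apply: no_fork vw uw _; rewrite sym_e.
have /fin_all_exists[b bP] i : exists bi : T -> 'I_k,
  forall u v, e_ i u v -> bi u != bi v.
  by apply/rel_colorableP; exact: ke (e_sym i) (e_sub i) (e_tf i).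
(* The product colouring: [u] gets the tuple of its colours in all [t] graphs. *)
pose B u := [ffun i => b i u].
have -> : k ^ t = #|{ffun 'I_t -> 'I_k}| by rewrite card_ffun !card_ord.
apply: (@rel_colorable_card _ _ _ B) => u v uv.
have [i euv] : exists i, e_ i u v.
  case: (ltngtP (enum_rank u) (enum_rank v)) => [lt_uv|lt_vu|/val_inj/enum_rank_inj eq_uv].
  - by exists (c u v); rewrite /e_ /= uv lt_uv eqxx.
  - by exists (c v u); rewrite /e_ /= [e v u]sym_e uv lt_vu eqxx orbT.
  (* A loop at [u] would lie in the neighbourhood of [u], which [c u] colours properly. *)
  - by move: uv (cP u u u); rewrite -eq_uv => ->; rewrite eqxx => /(_ isT).
apply: contraTneq (bP i u v euv) => /ffunP/(_ i).
by rewrite !ffunE => ->; rewrite eqxx.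
Qed.

(** Induction on [m]: if every neighbourhood has the colouring for [m], colouring by neighbourhoods
    adds one level to the tower of exponentials; otherwise the neighbourhood of some [v] contains a
    large clique, and [v] enlarges it. *)
Lemma large_clique_or_rel_colorable (m k : nat) (T : finType) (e : rel T) :
  symmetric e -> irreflexive e -> triangle_free_subrels_colorable e k ->
  (exists2 S : {set T}, rel_clique e S & m.+1 < #|S|) \/
  rel_colorable e (iter m (expn k) 1).
Proof.
elim: m e => [|m IHm] e sym_e irr_e ke.
  case: (boolP [exists u, exists v, e u v]) => [/existsP[u /existsP[v uv]]|no_edge].
    left; exists [set u; v] => [x y|].
      by rewrite !inE => /orP[]/eqP-> /orP[]/eqP->; rewrite ?eqxx // sym_e.
    rewrite cards2; suff -> : u != v by [].
    by apply: contraTneq uv => ->; rewrite irr_e.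
  right; apply/rel_colorableP; exists (fun=> ord0) => u v uv.
  by case/negP: no_edge; apply/existsP; exists u; apply/existsP; exists v.
pose nbhd v := [rel x y | [&& e x y, e v x & e v y]].
case: (boolP [forall v, rel_colorable (nbhd v) (iter m (expn k) 1)]) => [/forallP tv|].
  by right; apply: rel_colorable_neighborhoods.
rewrite negb_forall => /existsP[v /negP not_tv]; left.
have [||e' sym_e' sub_e'||//] := IHm (nbhd v).
- by move=> x y /=; rewrite sym_e [e v x && _]andbC.
- by move=> x /=; rewrite irr_e.
- by apply: ke => // x y /sub_e' /and3P[].
case=> S cS ltS.
(* [nbhd v] is a relation on all of [T], so membership in the neighbourhood is read off an edge to a
   second vertex of [S]. *)
have vS x : x \in S -> e v x.
  move=> xS; have /card_gt0P[y] : 0 < #|S :\ x| by move: ltS; rewrite (cardsD1 x) xS; lia.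
  by rewrite !inE eq_sym => /andP[xy yS]; have /and3P[] := cS _ _ xS yS xy.
exists (v |: S) => [x y|].
  rewrite !inE => /predU1P[->|xS] /predU1P[->|yS]; rewrite ?eqxx //.
  - by move=> _; apply: vS.
  - by move=> _; rewrite sym_e; apply: vS.
  - by case/(cS _ _ xS yS)/and3P.
by rewrite cardsU1; case: (boolP (v \in S)) => [/vS|_]; rewrite ?irr_e //= add1n.
Qed.

(** * Shift graphs inside cliques *)

(** Pairs that are not increasing are kept as isolated vertices, so that the vertex type is a full
    product. *)
Definition shift (n : nat) : rel ('I_n * 'I_n) :=
  [rel p q : 'I_n * 'I_n | [&& p.1 < p.2, q.1 < q.2 & (p.2 == q.1) || (q.2 == p.1)]].

Lemma shift_sym (n : nat) : symmetric (@shift n).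
Proof. by move=> p q; rewrite /shift /= andbCA orbC. Qed.

Lemma shift_triangle_free (n : nat) : triangle_free (@shift n).
Proof.
move=> [a a'] [b b'] [c c']; rewrite /shift /= -!val_eqE /=.
by move=> /and3P[? ? ?] /and3P[? ? ?] /and3P[? ? ?]; lia.
Qed.

(* The sets of colours on the pairs [(i, j)], for fixed [i], are distinct:
   the colour of [(i, j)] is absent from the set of [j]. *)
Lemma shift_colorable (n k : nat) : rel_colorable (@shift n) k -> n <= 2 ^ k.
Proof.
move=> /rel_colorableP[c cP].
pose A (i : 'I_n) := [set c (i, j) | j : 'I_n & i < j].
have neqA (i j : 'I_n) : i < j -> A i != A j.
  move=> ij; apply/eqP => eqA.
  have : c (i, j) \in A j by rewrite -eqA; apply/imsetP; exists j; rewrite ?inE.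
  case/imsetP=> l; rewrite inE => jl eqc.
  by have := cP (i, j) (j, l); rewrite /shift /= ij jl eqxx eqc eqxx => /(_ isT).
have injA : injective A.
  move=> i j eqA; apply: val_inj; case: (ltngtP i j) => // /neqA.
    by rewrite eqA eqxx.
  by rewrite eqA eqxx.
by have := leq_card A injA; rewrite card_ord -cardsT -powersetT card_powerset cardsT card_ord.
Qed.

(** With [n = 2 ^ k + 1], a clique on [n ^ 2] vertices would contain a copy of the shift graph,
    which is triangle-free but not [k]-colourable since [n] exceeds [2 ^ k]. *)
Lemma rel_clique_card (T : finType) (e : rel T) (k : nat) (S : {set T}) :
  triangle_free_subrels_colorable e k -> rel_clique e S -> #|S| < (2 ^ k).+1 ^ 2.
Proof.
move=> ke cS; rewrite ltnNge; apply/negP; set n := (2 ^ k).+1 => leS.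
have le_card : #|{: 'I_n * 'I_n}| <= #|S| by rewrite card_prod card_ord mulnn.
pose g (p : 'I_n * 'I_n) := enum_val (widen_ord le_card (enum_rank p)) : T.
have g_inj : injective g.
  by move=> p q /enum_val_inj/(congr1 val)/= eq_pq; apply/enum_rank_inj/val_inj.
have gS p : g p \in S by apply: enum_valP.
pose e' : rel T := [rel x y |
  [exists p, exists q, [&& x == g p, y == g q & shift p q]]].
have e'P x y : reflect (exists p q, [/\ x = g p, y = g q & shift p q]) (e' x y).
  apply: (iffP existsP) => [[p /existsP[q /and3P[/eqP-> /eqP-> pq]]]|[p [q [-> -> pq]]]].
    by exists p, q.
  by exists p; apply/existsP; exists q; rewrite !eqxx.
have : rel_colorable e' k.
  apply: ke.
  - move=> x y; apply/e'P/e'P => -[p [q [-> -> pq]]]; exists q, p;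
      by split=> //; rewrite shift_sym.
  - move=> x y /e'P[p [q [-> -> pq]]]; apply: cS => //.
    rewrite (inj_eq g_inj); apply/eqP => eq_pq.
    by rewrite eq_pq in pq; exact: (shift_triangle_free pq pq pq).
  - move=> x y z /e'P[p [q [-> -> pq]]] /e'P[_ [r [/g_inj <- -> qr]]].
    case/e'P => p' [r' [/g_inj <- /g_inj <- pr]].
    exact: shift_triangle_free pq qr pr.
case/rel_colorableP => c cP.
suff /shift_colorable : rel_colorable (@shift n) k by rewrite ltnn.
apply/rel_colorableP; exists (c \o g) => p q pq.
by apply: cP; apply/e'P; exists p, q.
Qed.

(** The height of the tower is the clique bound just found, which rules out the large clique. *)
Lemma rel_colorable_bound (T : finType) (e : rel T) (k : nat) :
  symmetric e -> irreflexive e -> triangle_free_subrels_colorable e k ->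
  rel_colorable e (iter ((2 ^ k).+1 ^ 2) (expn k) 1).
Proof.
move=> sym_e irr_e ke.
case: (large_clique_or_rel_colorable ((2 ^ k).+1 ^ 2) sym_e irr_e ke) => //.
by case=> S /(rel_clique_card ke); lia.
Qed.

(** * From relations back to graphs *)

Definition adj_rel (G : graph) : rel (vertices G) :=
  [rel u v | adj G (val u) (val v)].

Lemma adj_sym (G : graph) : symmetric (adj G).
Proof. by move=> u v; rewrite /adj fsetUC. Qed.

Lemma k_colorableE (G : graph) (k : nat) : k_colorable G k = rel_colorable (@adj_rel G) k.
Proof. by []. Qed.

Lemma chi_leP (G : graph) (k : nat) : (chi G <= k) = k_colorable G k.
Proof.
rewrite /chi; case: ex_minnP => l colG minl.
by apply/idP/idP => [le_lk|/minl//]; apply: rel_colorable_le colG.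
Qed.

Lemma omega_triangle_free (G : graph) : triangle_free (@adj_rel G) -> omega G <= 2.
Proof.
move=> tfG; apply/bigmax_leqP => S /forall_inP cS; rewrite leqNgt.
apply/negP => /card_gt2P[x [y [z [[xS yS zS] [xy yz zx]]]]].
have cl u v : u \in S -> v \in S -> u != v -> adj_rel u v.
  by move=> uS vS; apply/implyP; move/forall_inP: (cS u uS); apply.
by apply: (tfG x y z); apply: cl; rewrite // eq_sym.
Qed.

Section RelGraph.

Variables (V : {fset nat}) (e : rel V).

Definition rel_edges : {fset {fset nat}} :=
  [fset s in pairs V | [exists u, exists v, (s == [fset val u; val v]) && e u v]].

Lemma rel_edges_sub : rel_edges `<=` pairs V.
Proof. by apply/fsubsetP => s; rewrite !inE => /andP[]. Qed.

Definition rel_graph : graph := Graph rel_edges_sub.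

Hypotheses (sym_e : symmetric e) (irr_e : irreflexive e).

Lemma adj_rel_graph (u v : V) : adj rel_graph (val u) (val v) = e u v.
Proof.
rewrite /adj /= /rel_edges !inE /= fpowersetE.
apply/idP/idP => [/andP[/andP[_ uv2] /existsP[x /existsP[y /andP[/eqP uv_xy xy]]]]|uv].
  have neq_uv : u != v.
    by apply: contraTneq uv2 => ->; rewrite fsetUid cardfs1.
  have: val u \in [fset val x; val y] by rewrite -uv_xy !inE eqxx.
  have: val v \in [fset val x; val y] by rewrite -uv_xy !inE eqxx orbT.
  rewrite !inE !val_eqE => /orP[]/eqP eq_v /orP[]/eqP eq_u; subst u v => //.
  - by rewrite eqxx in neq_uv.
  - by rewrite sym_e.
  - by rewrite eqxx in neq_uv.
have neq_uv : val u != val v.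
  by rewrite val_eqE; apply: contraTneq uv => ->; rewrite irr_e.
rewrite cardfs2 neq_uv andbT; apply/andP; split.
  by apply/fsubsetP => x; rewrite !inE => /orP[]/eqP->; apply: valP.
by apply/existsP; exists u; apply/existsP; exists v; rewrite eqxx.
Qed.

End RelGraph.

(** This puts every spanning subgraph of [G] into the intersection of a class containing [G] with
    the class of all graphs. *)
Lemma graph_cap_rel_graph (G : graph) (e : rel (vertices G)) :
  subrel e (@adj_rel G) -> rel_graph e = graph_cap G (rel_graph e).
Proof.
move=> sub_e; apply: graph_eq; rewrite /= ?fsetIid //.
apply/esym/fsetIidPr/fsubsetP => s; rewrite !inE /=.
by case/andP=> _ /existsP[u /existsP[v /andP[/eqP-> /sub_e]]].
Qed.

(** A proper colouring of [G] restricts to the common vertices. *)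
Lemma chi_graph_cap (G H : graph) : chi (graph_cap G H) <= chi G.
Proof.
rewrite chi_leP k_colorableE.
have : k_colorable G (chi G) by rewrite -chi_leP.
rewrite k_colorableE => /rel_colorableP[c cP]; apply/rel_colorableP.
exists (c \o fincl (fsubsetIl (vertices G) (vertices H))) => u v uv.
by apply: cP; move: uv; rewrite /adj_rel /= /adj /= in_fsetI => /andP[].
Qed.

Theorem theorem2p1 (C : graph_class) (hC : hereditary C) :
  intersectionwise_chi_imposing C <-> colorable C.
Proof.
split=> [impC|[k kC] B _]; last first.
  exists (fun=> k); split=> // _ [G1 [G2 [/kC kG1 _ ->]]].
  exact: leq_trans (chi_graph_cap _ _) kG1.
(* Take for [B] the class of all graphs. Triangle-free subgraphs have clique number at most 2, hence
   the constant [f 2]. *)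
have [//|f [f_homo fP]] := impC (fun=> True).
exists (iter ((2 ^ f 2).+1 ^ 2) (expn (f 2)) 1) => G CG.
rewrite chi_leP k_colorableE.
apply: rel_colorable_bound => [u v|u|e sym_e sub_e tf_e].
- exact: adj_sym.
- exact: adj_irrefl.
have irr_e : irreflexive e by move=> u; apply/negP => uu; exact: (tf_e _ _ _ uu uu uu).
have adjE := adj_rel_graph sym_e irr_e.
have : chi (rel_graph e) <= f 2.
  (* The clique number may be below 2, so monotonicity of [f] is used. *)
  apply: leq_trans (f_homo _ _ _); last first.
    apply: (@omega_triangle_free (rel_graph e)) => u v w.
    by rewrite /adj_rel /= !adjE; apply: tf_e.
  apply: fP; exists G, (rel_graph e); split=> //.
  exact: graph_cap_rel_graph.
rewrite chi_leP k_colorableE => /rel_colorableP[c cP]; apply/rel_colorableP.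
by exists c => u v uv; apply: cP; rewrite /adj_rel /= adjE.
Qed.
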